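(* Let $A$ be a number field and let $\nu:\mathcal{I}_A\to\mathbb{N}=\{1,2,3,\dots\}$ be an additive function. Then there exist, for each nonzero prime ideal $\mathfrak{p}$ of $\mathcal{O}_A$, a monic irreducible polynomial $f_{\mathfrak{p},\nu}\in\mathbb{Q}[T]$ of degree $\nu(\mathfrak{p})$ whose splitting field has Galois group over $\mathbb{Q}$ cyclic of order $\nu(\mathfrak{p})$, and an automorphism $\sigma_\nu\in\mathrm{Gal}(\overline{\mathbb{Q}}/\mathbb{Q})$, such that, setting $f_{I,\nu}=\prod_{\mathfrak{p}\mid I}f_{\mathfrak{p},\nu}$ for $I\in\mathcal{I}_A$ (product over prime ideals dividing $I$, counted with multiplicity), for every square-free $I\in\mathcal{I}_A$ we have $$\mu_A(I)=(-1)^{\nu(I)}\operatorname{sign}(\sigma_\nu\mid f_{I,\nu}).$$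
   Context: $\mathcal{O}_A$ is the ring of integers of $A$ and $\mathcal{I}_A$ is the set of nonzero ideals of $\mathcal{O}_A$. ''Additive'' means $\nu(IJ)=\nu(I)+\nu(J)$ whenever $I,J$ are coprime. The Möbius function $\mu_A:\mathcal{I}_A\to\{-1,0,1\}$ is $\mu_A(I)=(-1)^r$ if $I=\mathfrak{p}_1\cdots\mathfrak{p}_r$ with distinct prime ideals $\mathfrak{p}_i$, and $0$ otherwise. For $I=\mathfrak{p}_1\cdots\mathfrak{p}_r$ square-free, $\operatorname{sign}(\sigma_\nu\mid f_{I,\nu})$ means $\prod_{i=1}^r\operatorname{sign}(\sigma_\nu\mid f_{\mathfrak{p}_i,\nu})$, where $\sigma_\nu\mid f$ denotes the permutation induced by $\sigma_\nu$ on the roots of an irreducible $f\in\mathbb{Q}[T]$ in $\overline{\mathbb{Q}}$, and $\operatorname{sign}$ is the sign of a permutation.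
   Formalization: Since O_A is coprime to itself, additivity forces ν(O_A)=0, so ν cannot take values only in {1,2,3,…}; the formal version lets ν take values in {0,1,2,…} and requires ν(I)≥1 only for nonzero ideals I≠O_A. *)

(* Defs.v *)
From HB Require Import structures.
From mathcomp Require Import all_boot all_order all_algebra all_fingroup all_solvable all_field.
Set Implicit Arguments. Unset Strict Implicit. Unset Printing Implicit Defensive.
Import Order.TTheory GRing.Theory Num.Theory.
Local Open Scope ring_scope.

Section NumberFieldIdeals.
Variable A : fieldExtType rat.

Definition integral (x : A) : Prop :=
  exists p : {poly int}, p \is monic /\ root (map_poly (fun z : int => z%:~R) p) x.

Definition ring_of_integers : A -> Prop := integral.

Definition is_ideal (I : A -> Prop) : Prop :=
  [/\ forall x, I x -> integral x,
      I 0,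
      forall x y, I x -> I y -> I (x + y)
    & forall a x, integral a -> I x -> I (a * x)].

Definition nz_ideal (I : A -> Prop) : Prop :=
  is_ideal I /\ exists x, I x /\ x <> 0.

Definition idmul (I J : A -> Prop) : A -> Prop := fun x =>
  exists s : seq (A * A),
    (forall ab, ab \in s -> I ab.1 /\ J ab.2) /\ x = \sum_(ab <- s) ab.1 * ab.2.

Definition idprod (ps : seq (A -> Prop)) : A -> Prop :=
  foldr idmul ring_of_integers ps.

Definition id_coprime (I J : A -> Prop) : Prop :=
  exists a b, I a /\ J b /\ a + b = 1.

Definition nz_prime_ideal (P : A -> Prop) : Prop :=
  [/\ nz_ideal P, ~ P 1 &
      forall a b, integral a -> integral b -> P (a * b) -> P a \/ P b].

Definition distinct_ideals (ps : seq (A -> Prop)) : Prop :=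
  forall i j, (i < size ps)%N -> (j < size ps)%N ->
    nth ring_of_integers ps i = nth ring_of_integers ps j -> i = j.

(* Moebius function on the square-free ideal I = p_1 ... p_r given by its
   factorization into the distinct primes ps = [:: p_1; ...; p_r] *)
Definition mobius_sqf (ps : seq (A -> Prop)) : int := (-1) ^+ size ps.

End NumberFieldIdeals.

Definition cyclic_galois_of_order (f : {poly rat}) (n : nat) : Prop :=
  exists E : splittingFieldType rat,
    splittingFieldFor 1%VS (map_poly (in_alg E) f) fullv /\
    cyclic 'Gal({:E} / (1%VS : {vspace E}))%g /\
    #|'Gal({:E} / (1%VS : {vspace E}))%g| = n.

Definition rootsC (f : {poly rat}) : seq algC :=
  sval (closed_field_poly_normal (map_poly ratr f)).

(* sign(sigma | f): the sign of the permutation induced by sigma on the roots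
   of f (indexed by their position in rootsC f). *)
Definition perm_sign_on (sigma : algC -> algC) (f : {poly rat}) : int :=
  let rs := rootsC f in
  let n := size rs in
  let g := fun i : 'I_n => index (sigma (nth 0 rs i)) rs in
  match [pick s : {perm 'I_n} | [forall i, (s i : nat) == g i]] with
  | Some s => (-1) ^+ odd_perm s
  | None => 0
  end.

(* Main.v *)
Require Import Defs.
From HB Require Import structures.
From mathcomp Require Import all_boot all_order all_algebra all_fingroup all_solvable all_field.
From mathcomp Require Import integral_char.
From Stdlib Require Import Classical ClassicalEpsilon FunctionalExtensionality PropExtensionality.
Import Order.TTheory GRing.Theory Num.Theory.
Local Open Scope ring_scope.

(** An [n]-cycle has sign [(-1)^(n-1)], so it suffices to find one automorphism
    [sigma] and, for every [n > 0], a cyclic polynomial [F n] of degree [n] on whose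
    roots [sigma] acts with the sign of an [n]-cycle; then [f P := F (nu P)] works,
    because distinct nonzero primes are coprime and [nu] is additive.  A power [c^k]
    of an [n]-cycle has the right sign as soon as [k] is odd or [n] is odd.  Write
    [n = 2^a m] with [m] odd.  In the cyclotomic field of conductor [2^(a+2) m^2],
    take the compositum of the real subfield of [Q(zeta_(2^(a+2)))], which is cyclic
    of degree [2^a], with any cyclic subfield of degree [m].  If [sigma] sends
    [zeta_8] to [zeta_8^5], then [sigma] generates the Galois group of each of these
    real subfields, which forces [k] to be odd when [n] is even. *)

(** * Ideals of the ring of integers *)

Section Ideals.
Variable A : fieldExtType rat.
Implicit Types (I J P Q : A -> Prop) (x y : A).

Lemma ideal_ext I J : (forall x, I x <-> J x) -> I = J.
Proof.
move=> eqIJ; apply: functional_extensionality => x.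
exact: propositional_extensionality.
Qed.

Lemma integral_overE x : integral x <-> integralOver (intr : int -> A) x.
Proof. by split=> [[p [? ?]] | [p ? ?]]; exists p. Qed.

Lemma integralD x y : integral x -> integral y -> integral (x + y).
Proof. by rewrite !integral_overE; apply: integral_add. Qed.

Lemma integralM x y : integral x -> integral y -> integral (x * y).
Proof. by rewrite !integral_overE; apply: integral_mul. Qed.

Lemma integralN x : integral x -> integral (- x).
Proof. by rewrite !integral_overE; apply: integral_opp. Qed.

Lemma integral_intr (z : int) : integral (z%:~R : A).
Proof. by rewrite integral_overE; apply: integral_id. Qed.

Lemma integral_horner_int (q : {poly int}) x :
  integral x -> integral (map_poly intr q).[x].
Proof.
rewrite !integral_overE => intx; apply: integral_horner => //.
by apply/integral_poly => i; rewrite coef_map; apply: integral_id.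
Qed.

Lemma integral1A : integral (1 : A).
Proof. exact: (integral_intr 1). Qed.

Lemma integral0A : integral (0 : A).
Proof. exact: (integral_intr 0). Qed.

Lemma integralX x n : integral x -> integral (x ^+ n).
Proof.
move=> intx; elim: n => [|n IHn]; first exact: integral1A.
by rewrite exprS; apply: integralM.
Qed.

Lemma ideal_sum {I} (T : eqType) (s : seq T) (F : T -> A) :
  is_ideal I -> (forall t, t \in s -> I (F t)) -> I (\sum_(t <- s) F t).
Proof.
case=> [_ I0 ID _]; elim: s => [|t s IHs] IF; first by rewrite big_nil.
rewrite big_cons; apply: ID; first exact/IF/mem_head.
by apply: IHs => u us; apply: IF; rewrite inE us orbT.
Qed.

Lemma ideal_idmul {I J} : is_ideal I -> is_ideal J -> is_ideal (idmul I J).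
Proof.
move=> idI idJ; have [intI I0 ID IM] := idI; have [intJ J0 JD JM] := idJ; split.
- have O_ideal : is_ideal (@integral A).
    split=> //; [exact: integral0A | exact: integralD | exact: integralM].
  move=> _ [s [sIJ ->]]; apply: (ideal_sum _ _ _ O_ideal) => ab /sIJ[Ia Jb].
  by apply: integralM; [apply: intI | apply: intJ].
- by exists [::]; split=> //; rewrite big_nil.
- move=> _ _ [s [sIJ ->]] [t [tIJ ->]]; exists (s ++ t); rewrite big_cat.
  by split=> // ab; rewrite mem_cat => /orP[/sIJ | /tIJ].
move=> a _ inta [s [sIJ ->]]; exists [seq (a * ab.1, ab.2) | ab <- s].
rewrite big_map mulr_sumr; split; last by apply: eq_bigr => ab _; rewrite mulrA.
by move=> _ /mapP[ab /sIJ[Ia Jb] ->]; split=> //; apply: IM.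
Qed.

Lemma mem_idmul {I J x y} : I x -> J y -> idmul I J (x * y).
Proof.
by move=> Ix Jy; exists [:: (x, y)]; rewrite big_seq1; split=> // _ /[1!inE] /eqP->.
Qed.

Lemma nz_ideal_idmul {I J} : nz_ideal I -> nz_ideal J -> nz_ideal (idmul I J).
Proof.
move=> [idI [x [Ix /eqP nz_x]]] [idJ [y [Jy /eqP nz_y]]].
split; first exact: ideal_idmul.
exists (x * y); split; first exact: mem_idmul.
by apply/eqP; rewrite mulf_neq0.
Qed.

Lemma nz_ideal_integers : nz_ideal (@ring_of_integers A).
Proof.
split; last by exists 1; split; [exact: integral1A | apply/eqP/oner_neq0].
split=> //; [exact: integral0A | exact: integralD | exact: integralM].
Qed.

Lemma idmul_integers : idmul (@ring_of_integers A) (@ring_of_integers A) =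
  @ring_of_integers A.
Proof.
apply: ideal_ext => x; split.
  have [idO _] := nz_ideal_integers.
  by have [+ _ _ _] := ideal_idmul idO idO; apply.
by move=> Ox; rewrite -[x]mul1r; apply: mem_idmul; first exact: integral1A.
Qed.

Lemma id_coprime_integers I : is_ideal I -> id_coprime I (@ring_of_integers A).
Proof.
by case=> _ I0 _ _; exists 0, 1; rewrite add0r; split=> //; split; first exact: integral1A.
Qed.

Lemma id_coprime_mulr {I J1 J2} : is_ideal I -> is_ideal J1 -> is_ideal J2 ->
  id_coprime I J1 -> id_coprime I J2 -> id_coprime I (idmul J1 J2).
Proof.
move=> [intI I0 ID IM] [intJ1 _ _ _] [intJ2 _ _ _].
move=> [a1 [b1 [Ia1 [Jb1 e1]]]] [a2 [b2 [Ia2 [Jb2 e2]]]].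
(* Expanding (a1 + b1)(a2 + b2) = 1 leaves b1 b2 as the only term without a factor from [I]. *)
exists ((a2 + b2) * a1 + b1 * a2), (b1 * b2); split.
  by apply: ID; apply: IM; rewrite ?e2; try exact: integral1A; try exact: intJ1.
split; first exact: mem_idmul.
by rewrite -addrA -mulrDr e2 mul1r mulr1.
Qed.

(** Take a nonzero [x] in [I] and strip the powers of 'X from an integral equation of [x]: the
    constant term that remains is a nonzero integer and an integral multiple of [x]. *)
Lemma nz_ideal_int I : nz_ideal I -> exists2 d : nat, (0 < d)%N & I d%:R.
Proof.
case=> idI [x [Ix /eqP nz_x]]; have [intI I0 ID IM] := idI.
have intx := intI x Ix.
suffices [z nz_z Iz] : exists2 z : int, z != 0 & I z%:~R.
  exists `|z|%N; first by rewrite absz_gt0.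
  rewrite -[_%:R]/(`|z|%N%:~R) abszEsg rmorphM mulrC /= mulrC; apply: IM => //.
  exact: integral_intr.
case: intx => p [/monic_neq0]; elim/poly_ind: p => [|p c IHp]; first by rewrite eqxx.
have [-> | nz_c _] := eqVneq c 0.
  rewrite addr0 => nz_pX; rewrite rmorphM /= map_polyX rootM rootX (negPf nz_x) orbF.
  by apply: IHp; apply: contraNneq nz_pX => ->; rewrite mul0r.
rewrite rmorphD rmorphM /= map_polyX map_polyC /root !hornerE addr_eq0 => /eqP pxc.
exists (- c); first by rewrite oppr_eq0.
rewrite rmorphN /= -pxc; apply: IM => //.
exact: integral_horner_int (intI x Ix).
Qed.

(* Pigeonhole on the remainders of 'X^i modulo d and a monic integral equation of x. *)
Lemma integral_power_collision d x : (0 < d)%N -> integral x ->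
  exists i k y, integral y /\ x ^+ i * (1 - x ^+ k.+1) = d%:R * y.
Proof.
move=> d_gt0 intx; have [p [mon_p px0]] := intx.
case: d d_gt0 => // d _; pose T := {ffun 'I_(size p) -> 'I_d.+1}.
pose r i := Pdiv.Ring.rmodp 'X^i p.
pose g (i : 'I_#|T|.+1) : T := [ffun l => inord `|((r i)`_(l : 'I_(size p)) %% d.+1)%Z|].
have /injectivePn[i [j neq_ij eq_g]] : ~~ injectiveb g.
  by apply/injectiveP => /leq_card; rewrite card_ord ltnn.
have rE u : x ^+ u = (map_poly intr (r u)).[x].
  rewrite -[x in LHS]hornerX -hornerXn hornerX.
  rewrite -[in LHS](map_polyXn (intr : int -> A)).
  rewrite {1}(Pdiv.RingMonic.rdivp_eq mon_p 'X^u) rmorphD rmorphM /= hornerD hornerM.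
  by rewrite (rootP px0) mulr0 add0r.
have r_size u : (size (r u) <= size p)%N.
  by rewrite ltnW // Pdiv.Ring.ltn_rmodpN0 ?monic_neq0.
have [t rt] : exists t, r i - r j = d.+1%:Z *: t.
  exists (\poly_(l < size p) (((r i - r j)`_l) %/ d.+1)%Z).
  apply/polyP=> l; rewrite coefZ coef_poly; case: ltnP => [lt_lp | le_pl].
    have /ffunP/(_ (Ordinal lt_lp)) := eq_g; rewrite !ffunE /=.
    move/(congr1 (val : 'I_d.+1 -> nat)).
    have lt_mod (z : int) : (`|(z %% d.+1)%Z| < d.+1)%N.
      by rewrite -ltz_nat gez0_abs ?ltz_pmod ?modz_ge0.
    rewrite /= !inordK // => /(congr1 Posz); rewrite !gez0_abs ?modz_ge0 //.
    move/eqP; rewrite eqz_mod_dvd => dv_r.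
    by rewrite mulrC divzK // coefB.
  by rewrite mulr0 coefB !nth_default ?subrr // (leq_trans (r_size _)).
have collision u v : (u < v)%N -> r u - r v = d.+1%:Z *: t \/ r v - r u = d.+1%:Z *: t ->
  exists i k y, integral y /\ x ^+ i * (1 - x ^+ k.+1) = d.+1%:R * y.
  move=> lt_uv ruv; exists u, (v - u.+1)%N.
  rewrite mulrBr mulr1 -exprD -subSn // subSS subnKC ?(ltnW lt_uv) // !rE.
  have hornerrt : (map_poly (intr : int -> A) (d.+1%:Z *: t)).[x] =
      d.+1%:R * (map_poly intr t).[x] by rewrite map_polyZ hornerZ.
  have intt := integral_horner_int t x intx.
  case: ruv => [ruv | ruv].
    exists (map_poly intr t).[x]; split=> //.
    by rewrite -hornerrt -ruv rmorphB hornerD hornerN.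
  exists (- (map_poly intr t).[x]); split; first exact: integralN.
  by rewrite mulrN -hornerrt -ruv rmorphB hornerD hornerN opprB.
move: neq_ij; rewrite -val_eqE neq_ltn => /orP[lt_ij | lt_ji].
  by apply: (collision i j) => //; left.
by apply: (collision j i) => //; right.
Qed.

(** Two powers of [x] collide modulo a positive integer of [P], so [P] contains some x^i (1 -
    x^(k+1)). Primality removes the factors [x] one by one, and x^k is then an inverse of [x] modulo
    [P]. *)
Lemma nz_prime_maximal P x : nz_prime_ideal P -> integral x -> ~ P x ->
  exists2 y, integral y & P (1 - x * y).
Proof.
case=> nzP _ primeP intx notPx; have [d d_gt0 Pd] := nz_ideal_int P nzP.
have [[intP P0 PD PM] _] := nzP.
have [i [k [y [inty dy]]]] := integral_power_collision d x d_gt0 intx.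
exists (x ^+ k); first exact: integralX.
rewrite -exprS; set z := 1 - _ in dy *.
have intz : integral z by apply: integralD; [exact: integral1A | exact/integralN/integralX].
have: P (x ^+ i * z) by rewrite dy mulrC; apply: PM.
elim: i {dy} => [|i IHi]; first by rewrite mul1r.
rewrite exprS -mulrA => /primeP[|//||//]//.
by apply: integralM => //; apply: integralX.
Qed.

(** If [x] lies in [Q] but not in [P] and [y] inverts it modulo [P], then 1 = (1 - xy) + xy. If
    instead [x] lies only in [P], the roles are exchanged. *)
Lemma nz_prime_coprime P Q : nz_prime_ideal P -> nz_prime_ideal Q -> P <> Q ->
  id_coprime P Q.
Proof.
have half P' Q' x : nz_prime_ideal P' -> nz_prime_ideal Q' -> Q' x -> ~ P' x -> id_coprime P' Q'.
  move=> prP [[[intQ _ _ QM] _] _ _] Qx notPx.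
  have [y inty Py] := nz_prime_maximal P' x prP (intQ x Qx) notPx.
  exists (1 - x * y), (x * y); rewrite subrK; split=> //; split=> //.
  by rewrite mulrC; apply: QM.
move=> prP prQ neqPQ; apply: NNPP => ncoPQ; apply: neqPQ; apply: ideal_ext => x.
split=> [Px | Qx]; apply: NNPP => notx; apply: ncoPQ; last exact: (half P Q x).
by have [a [b [Qa [Pb e]]]] := half Q P x prQ prP Px notx; exists b, a; rewrite addrC.
Qed.

Lemma nz_ideal_idprod (ps : seq (A -> Prop)) :
  (forall i, (i < size ps)%N -> nz_ideal (nth (@ring_of_integers A) ps i)) ->
  nz_ideal (idprod ps).
Proof.
elim: ps => [|P ps IHps] nzps; first exact: nz_ideal_integers.
by apply: nz_ideal_idmul; [exact: (nzps 0%N) | apply: IHps => i; apply: (nzps i.+1)].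
Qed.

Lemma id_coprime_idprod P (ps : seq (A -> Prop)) : is_ideal P ->
  (forall i, (i < size ps)%N -> nz_ideal (nth (@ring_of_integers A) ps i) /\
     id_coprime P (nth (@ring_of_integers A) ps i)) ->
  id_coprime P (idprod ps).
Proof.
move=> idP; elim: ps => [|Q ps IHps] cops; first exact: id_coprime_integers.
have [[idQ _] coPQ] := cops 0%N (ltn0Sn _).
apply: id_coprime_mulr => //; last by apply: IHps => i; apply: (cops i.+1).
by case: (nz_ideal_idprod ps) => // i lti; case: (cops i.+1 lti).
Qed.

Lemma additive_idprod (nu : (A -> Prop) -> nat) (ps : seq (A -> Prop)) :
  (forall I J, nz_ideal I -> nz_ideal J -> id_coprime I J ->
     nu (idmul I J) = (nu I + nu J)%N) ->
  (forall i, (i < size ps)%N -> nz_prime_ideal (nth (@ring_of_integers A) ps i)) ->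
  distinct_ideals ps ->
  nu (idprod ps) = (\sum_(P <- ps) nu P)%N.
Proof.
move=> nuD; elim: ps => [|P ps IHps] prps dps.
  (* The unit ideal is coprime to itself and equal to its own square, so additivity forces [nu] to
     vanish on it; this is the case of the empty product. *)
  have nzO := nz_ideal_integers; have coOO := id_coprime_integers _ (proj1 nzO).
  have /eqP := nuD _ _ nzO nzO coOO.
  by rewrite idmul_integers -[X in X == _]addn0 eqn_add2l big_nil => /eqP <-.
have prP : nz_prime_ideal P := prps 0%N (ltn0Sn _).
have {}prps i : (i < size ps)%N -> nz_prime_ideal (nth (@ring_of_integers A) ps i).
  exact: (prps i.+1).
have nzps i : (i < size ps)%N -> nz_ideal (nth (@ring_of_integers A) ps i).
  by case/prps.
have [nzP _ _] := prP; rewrite big_cons /= nuD //; last first.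
- apply: id_coprime_idprod; first by case: nzP.
  move=> i lti; split; first exact: nzps.
  apply: nz_prime_coprime => //; first exact: prps.
  by move=> eqP; have := dps 0%N i.+1 (ltn0Sn _) lti eqP.
- exact: nz_ideal_idprod.
rewrite IHps // => i j lti ltj eqij.
exact/succn_inj/(dps i.+1 j.+1 lti ltj eqij).
Qed.

End Ideals.

(** * Cyclic quotients of abelian groups *)

Section CyclicQuotient.
Local Open Scope nat_scope.
Local Open Scope group_scope.
Variable gT : finGroupType.
Implicit Types (G H : {group gT}) (c g : gT) (n : nat).

(* For abelian G: the quotient G / H is cyclic of order n, generated by c H. *)
Definition cyclic_mod G H c n : Prop :=
  [/\ c \in G, H \subset G, G \subset <[c]> * H
    & forall i, (c ^+ i \in H) = (n %| i)].

Lemma cyclic_mod_coset {G H c n g} : cyclic_mod G H c n -> g \in G ->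
  exists i, c ^- i * g \in H.
Proof.
case=> _ _ /subsetP gen _ /gen /mulsgP[_ h /cycleP[i ->] Hh ->].
by exists i; rewrite mulKg.
Qed.

Lemma cyclic_mod_expg {G H c n g i} j : abelian G -> cyclic_mod G H c n ->
  g \in G -> c ^- i * g \in H -> c ^- (i * j) * g ^+ j \in H.
Proof.
move=> cGG [Gc _ _ _] Gg Hg.
have cgc : commute (c ^- i) g by apply: (centsP cGG); rewrite ?groupV ?groupX.
by have := groupX j Hg; rewrite expgMn // -expgVn -!expgM expgVn.
Qed.

Lemma cyclic_mod_eqmod {G H c n} i j : cyclic_mod G H c n -> i = j %[mod n] ->
  c ^+ i * c ^- j \in H.
Proof.
case=> _ _ _ ord eq_ij; rewrite (divn_eq i n) (divn_eq j n) eq_ij.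
rewrite !expgD invMg mulgA mulgK.
by apply: groupM; rewrite ?groupV ord dvdn_mull.
Qed.

(** Chinese remainder theorem: G / (H1 :&: H2) embeds into the product of the cyclic groups G / H1
    and G / H2, whose orders are coprime. On the field side, the compositum of two cyclic fields of
    coprime degrees is cyclic. *)
Lemma cyclic_modI {G H1 H2 c1 c2 n1 n2} : abelian G -> coprime n1 n2 ->
  (0 < n1)%N -> (0 < n2)%N ->
  cyclic_mod G H1 c1 n1 -> cyclic_mod G H2 c2 n2 ->
  exists c, cyclic_mod G (H1 :&: H2)%G c (n1 * n2).
Proof.
move=> cGG co_n n1_gt0 n2_gt0 cm1 cm2.
have [Gc1 sH1G gen1 ord1] := cm1; have [Gc2 sH2G gen2 ord2] := cm2.
have in1 : c2 ^+ n1 \in H1.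
  have [j Hj] := cyclic_mod_coset cm1 Gc2.
  have := cyclic_mod_expg n1 cGG cm1 Gc2 Hj.
  by rewrite groupMl // groupV ord1 dvdn_mull.
have in2 : c1 ^+ n2 \in H2.
  have [j Hj] := cyclic_mod_coset cm2 Gc1.
  have := cyclic_mod_expg n2 cGG cm2 Gc1 Hj.
  by rewrite groupMl // groupV ord2 dvdn_mull.
(* Modulo [H1] this is c1^n2, still a generator because n2 is prime to n1; symmetrically modulo
   [H2]. *)
pose c := c1 ^+ n2 * c2 ^+ n1.
have Gc : c \in G by rewrite groupM ?groupX.
have cE i : c ^+ i = c1 ^+ (n2 * i) * c2 ^+ (n1 * i).
  by rewrite expgMn -?expgM //; apply: (centsP cGG); rewrite groupX.
have cE1 i h : (c ^+ i * h \in H1) = (c1 ^+ (n2 * i) * h \in H1).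
  have cc : commute (c2 ^+ (n1 * i)) (c1 ^+ (n2 * i)).
    by apply: (centsP cGG); rewrite groupX.
  by rewrite cE -cc -mulgA groupMl // expgM groupX.
have cE2 i h : (c ^+ i * h \in H2) = (c2 ^+ (n1 * i) * h \in H2).
  by rewrite cE -mulgA groupMl // expgM groupX.
exists c; split=> //.
- by rewrite subIset // sH1G.
- apply/subsetP => g Gg.
  (* The exponents are taken for the inverse of [g], so that the goal becomes c^i g in both
     subgroups; [i] is then found from its residues modulo n1 and n2. *)
  have [a Ha] := cyclic_mod_coset cm1 (groupVr Gg).
  have [b Hb] := cyclic_mod_coset cm2 (groupVr Gg).
  have [i ia ib] : exists2 i, n2 * i = a %[mod n1] & n1 * i = b %[mod n2].
    have [u1 [v1 e1]] : exists u v, (n2 * u = v * n1 + 1)%N.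
      by have [u v e _] := egcdnP n1 n2_gt0; exists u, v; rewrite mulnC e gcdnC (eqP co_n).
    have [u2 [v2 e2]] : exists u v, (n1 * u = v * n2 + 1)%N.
      by have [u v e _] := egcdnP n2 n1_gt0; exists u, v; rewrite mulnC e (eqP co_n).
    exists (chinese n1 n2 (u1 * a) (u2 * b)).
      by rewrite -modnMmr chinese_modl // modnMmr mulnA e1 mulnDl mul1n -mulnAC modnMDl.
    by rewrite -modnMmr chinese_modr // modnMmr mulnA e2 mulnDl mul1n -mulnAC modnMDl.
  have Hci : c ^+ i * g \in H1 :&: H2.
    have cV d e : d \in G -> d ^- e * g^-1 = (d ^+ e * g)^-1.
      by move=> Gd; rewrite invMg; apply: (centsP cGG); rewrite ?groupV ?groupX.
    rewrite inE cE1 cE2; apply/andP; split.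
      rewrite -[X in X * _](mulgKV (c1 ^+ a)) -mulgA; apply: groupM.
        exact: cyclic_mod_eqmod cm1 ia.
      by rewrite -groupV -cV.
    rewrite -[X in X * _](mulgKV (c2 ^+ b)) -mulgA; apply: groupM.
      exact: cyclic_mod_eqmod cm2 ib.
    by rewrite -groupV -cV.
  by rewrite -[g](mulKg (c ^+ i)) mem_mulg // groupV mem_cycle.
move=> i; rewrite inE -[c ^+ i]mulg1 cE1 cE2 !mulg1 ord1 ord2 !Gauss_dvdr //.
  by rewrite Gauss_dvd.
by rewrite coprime_sym.
Qed.

(** Modulo [H1], c is some s^j and s is c^k, so jk = 1 modulo the even number n1; hence jk is odd,
    and so is k. This controls the parity of the power of [c] by which sigma acts. *)
Lemma odd_cyclic_mod {G H H1 s c n n1 k} : abelian G -> ~~ odd n1 ->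
  cyclic_mod G H1 s n1 -> cyclic_mod G H c n -> H \subset H1 ->
  c ^- k * s \in H -> odd k.
Proof.
move=> cGG ev_n1 cm1 cm sHH1 Hs; have [Gs _ _ ord1] := cm1; have [Gc _ _ _] := cm.
have [j Hj] := cyclic_mod_coset cm1 Gc.
have := cyclic_mod_expg k cGG cm1 Gc Hj.
move/(groupM)/(_ (subsetP sHH1 _ Hs)); rewrite -mulgA mulKVg => H1s.
suffices: odd (j * k) by rewrite oddM => /andP[].
case: (j * k)%N H1s => [|m].
  by rewrite invg1 mul1g -[s]expg1 ord1 dvdn1 => /eqP n11; rewrite n11 in ev_n1.
rewrite expgS invMg mulgKV groupV ord1 => /dvdnP[q ->] /=.
by rewrite oddM (negPf ev_n1) andbF.
Qed.

(** An element [x] whose order is the exponent of [G] generates a direct factor, with a complement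
    [K]. Dividing [G] by <x^n> K leaves <x> / <x^n>, of order n. *)
Lemma cyclic_mod_exponent G n : abelian G -> (n %| exponent G)%N ->
  exists (H : {group gT}) c, cyclic_mod G H c n.
Proof.
move=> cGG dv_n; have [x Gx ox] := exponent_witness (abelian_nil cGG).
have /splitsP[K /complP[tixK defG]] := abelian_splits Gx (esym ox) cGG.
have sKG : K \subset G by rewrite -defG mulG_subr.
have sxG : <[x ^+ n]> \subset G by rewrite cycle_subG groupX.
have cxK : commute <[x ^+ n]> K by apply: normC; rewrite (subset_trans sxG) // sub_abelian_norm.
have defHx := comm_joingE cxK.
exists (<[x ^+ n]> <*> K)%G, x; split=> //=.
- by rewrite join_subG sxG.
- by rewrite -defG mulgS // joing_subr.
move=> i; rewrite defHx; apply/mulsgP/idP => [[_ k /cycleP[j ->] Kk xik] | /dvdnP[j ->]].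
  have : k \in <[x]> :&: K.
    by rewrite inE Kk andbT -(groupMl _ (groupX j (mem_cycle x n))) -xik mem_cycle.
  rewrite tixK => /set1gP k1; move/eqP: xik; rewrite k1 mulg1 -expgM eq_expg_mod_order -ox.
  by move/eqP/(congr1 (modn^~ n)); rewrite /= !modn_dvdm // modnMr /dvdn => ->.
by exists (x ^+ n ^+ j) 1; rewrite ?mem_cycle ?mulg1 // -expgM mulnC.
Qed.

End CyclicQuotient.

(** * Cyclic subfields *)

Lemma iter_injective {T : Type} (f : T -> T) n : injective f -> injective (iter n f).
Proof. by move=> injf; elim: n => // n IHn x y /injf/IHn. Qed.

Lemma iter_period_inj {T : eqType} (f : T -> T) x n : injective f ->
  (forall i, (iter i f x == x) = (n %| i)%N) ->
  forall i j, (iter i f x == iter j f x) = (i == j %[mod n])%N.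
Proof.
move=> injf period i j; wlog le_ij : i j / (i <= j)%N.
  move=> IH; case/orP: (leq_total i j) => le_ij; first exact: IH.
  by rewrite eq_sym IH // eq_sym.
rewrite -(subnKC le_ij) iterD (inj_eq (iter_injective f i injf)) eq_sym period.
by rewrite [RHS]eq_sym eqn_mod_dvd ?leq_addr // addKn.
Qed.

Lemma uniq_traject_period {T : eqType} (f : T -> T) x n : injective f ->
  (forall i, (iter i f x == x) = (n %| i)%N) -> uniq (traject f x n).
Proof.
move=> injf period; apply/(uniqP x) => i j; rewrite !inE size_traject => lti ltj.
rewrite !nth_traject // => /eqP; rewrite (iter_period_inj f x n) //.
by rewrite !modn_small // => /eqP.
Qed.

Lemma mem_traject_period {T : eqType} (f : T -> T) x n i : injective f ->
  (0 < n)%N -> (forall i, (iter i f x == x) = (n %| i)%N) ->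
  iter i f x \in traject f x n.
Proof.
move=> injf n_gt0 period; apply/trajectP; exists (i %% n)%N; first exact: ltn_pmod.
by apply/eqP; rewrite (iter_period_inj f x n) // modn_mod.
Qed.

Section CyclicSubfield.
Variables (L : splittingFieldType rat) (galL : galois 1 {:L}).
Let G := 'Gal({:L} / 1)%G.
Implicit Types (g c : gal_of {:L}) (H : {group gal_of {:L}}).

Lemma galX c i x : (c ^+ i)%g x = iter i c x.
Proof.
elim: i => [|i IHi]; first by rewrite gal_id.
by rewrite expgSr galM ?memvf // IHi.
Qed.

Lemma gal_eq_adjoin (g h : gal_of {:L}) x a : a \in <<1; x>>%VS -> g x = h x -> g a = h a.
Proof.
case/Fadjoin_polyP=> p p1 -> ghx; rewrite -!horner_map /= ghx.
suffices -> : map_poly g p = map_poly h p by [].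
apply/polyP => i; rewrite !coef_map /=.
by have /vlineP[r ->] := polyOverP p1 i; rewrite !linearZ !rmorph1.
Qed.

Lemma mem_gal_adjoin g x : (g \in 'Gal({:L} / <<1; x>>)%g) = (g x == x).
Proof.
rewrite gal_kHom ?subvf //.
apply/kAHomP/eqP => [-> // | gx a ax]; first exact: memv_adjoin.
by rewrite -[RHS](gal_id {:L}); apply: (gal_eq_adjoin _ _ x) => //; rewrite gal_id.
Qed.

(** By the Galois correspondence, a primitive element of the fixed field of [H] has stabilizer
    exactly [H]. *)
Lemma stabilizer_generator H : exists x, forall g, (g x == x) = (g \in H).
Proof.
have [_ sepL _] := and3P galL.
pose K := fixedField H; pose x := separable_generator 1 K.
have genK : K = <<1; x>>%VS :> {vspace L}.
  apply: eq_adjoin_separable_generator; last exact: sub1v.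
  by apply: separableSr sepL; apply: subvf.
by exists x => g; rewrite -mem_gal_adjoin -genK gal_fixedField.
Qed.

Lemma cyclic_mod_iter H c n g x : abelian G -> cyclic_mod _ G H c n ->
  (forall g, (g x == x) = (g \in H)) -> g \in G -> exists i, g x = iter i c x.
Proof.
move=> cGG cmc stabx Gg; have [Gc _ _ _] := cmc.
have [i Hi] := cyclic_mod_coset _ cmc Gg; exists i.
(* By [galM] the left factor acts first, so the part c^-i g, which fixes [x], is put on the left. *)
have -> : g = (c ^- i * g * c ^+ i)%g.
  by rewrite -mulgA (centsP cGG g) ?groupX // mulKg.
by rewrite galM ?memvf // galX; move: Hi; rewrite -stabx => /eqP->.
Qed.

(** The conjugates of [x] are its images under [G]. Since c generates G / H and [H] is the
    stabilizer of [x], they form a single orbit of [c], of length n. *)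
Lemma minPoly_cyclic H c n x : abelian G -> (0 < n)%N -> cyclic_mod _ G H c n ->
  (forall g, (g x == x) = (g \in H)) ->
  minPoly 1 x = \prod_(a <- traject c x n) ('X - a%:P).
Proof.
move=> cGG n_gt0 cmc stabx; have [Gc sHG gen ord] := cmc.
have itcP i : (iter i c x == x) = (n %| i)%N by rewrite -galX stabx ord.
have [r [/subsetP sr uniq_r Dp]] := galois_factors (sub1v {:L}) galL x (memvf x).
rewrite Dp; apply/perm_big/uniq_perm => //.
  exact: (uniq_traject_period _ _ _ (fmorph_inj _)).
move=> a; apply/mapP/idP => [[g /sr Gg ->] | /trajectP[i _ ->]].
  have [i ->] := cyclic_mod_iter _ _ _ _ _ cGG cmc stabx Gg.
  exact: mem_traject_period (fmorph_inj _) n_gt0 itcP.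
apply/mapP; rewrite -root_prod_XsubC -Dp -galX root_minPoly_gal ?sub1v ?memvf //.
by rewrite groupX.
Qed.
End CyclicSubfield.

(** * Real subfields of 2-power cyclotomic fields *)

Lemma iter_rmorphism {R : pzRingType} (c : {rmorphism R -> R}) i :
  exists u : {rmorphism R -> R}, forall x, u x = iter i c x.
Proof.
elim: i => [|i [u uE]]; first by exists idfun.
by exists (c \o u) => x; rewrite /= uE.
Qed.

Section TwoPower.
Variable sigma : {rmorphism algC -> algC}.
(** As 5 is 1 modulo 4 but not modulo 8, such a sigma fixes the square roots of -1 and negates the
    primitive eighth roots of unity. *)
Hypothesis sigma8 : forall z, z ^+ 8 = 1 -> sigma z = z ^+ 5.
Implicit Type z : algC.

Lemma root_neq0 a (z : algC) : z ^+ (2 ^ a) = -1 -> z != 0.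
Proof.
by move=> zN1; apply: contra_eq_neq zN1 => ->; rewrite expr0n expn_eq0 eq_sym oppr_eq0 oner_eq0.
Qed.

(* Inductive step: the power u of sigma that negates z^2 multiplies z by a square root
   e of -1, which sigma fixes; hence u^2 negates z. *)
Lemma iter_sigma_flip a z : z ^+ (2 ^ a.+2) = -1 -> iter (2 ^ a) sigma z = - z.
Proof.
elim: a z => [|a IHa] z zN1.
  have z8 : z ^+ 8 = 1 by rewrite (exprM z 4 2) zN1 sqrrN expr1n.
  by rewrite /= sigma8 // exprS zN1 mulrN1.
have z2 : (z ^+ 2) ^+ (2 ^ a.+2) = -1 by rewrite -exprM -expnS.
have [u uE] := iter_rmorphism sigma (2 ^ a).
have nz_z := root_neq0 _ _ zN1.
pose e := u z / z; have uz : u z = e * z by rewrite divfK.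
have e2 : e ^+ 2 = -1.
  by rewrite expr_div_n -rmorphXn uE IHa // mulNr divff // expf_neq0.
have ue : u e = e.
  rewrite uE iter_fix // sigma8; first by rewrite exprS (exprM e 2 2) e2 sqrrN expr1n mulr1.
  by rewrite (exprM e 2 4) e2 -signr_odd.
rewrite expnS mul2n -addnn iterD -!uE uz rmorphM ue uz mulrA -expr2 e2.
by rewrite mulN1r.
Qed.

(** Relates the real generator z + 1/z to the one built from z^2; the inductions on [a] below
    descend along this tower of quadratic extensions. *)
Lemma add_inv_sqr (z : algC) : z != 0 -> (z + z^-1) ^+ 2 = (z ^+ 2 + (z ^+ 2)^-1) + 2.
Proof.
by move=> nz; rewrite sqrrD mulfV // exprVn addrAC.
Qed.

Lemma add_inv_eq0 (z : algC) : z != 0 -> (z + z^-1 == 0) = (z ^+ 2 == -1).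
Proof.
by move=> nz; rewrite -(mulIr_eq0 _ (mulIf nz)) mulrDl mulVf // -expr2 addr_eq0.
Qed.

Lemma iter_sigma_flip_add a z : z ^+ (2 ^ a.+2) = -1 ->
  iter (2 ^ a) sigma (z + z^-1) = - (z + z^-1).
Proof.
move=> zN1; have [u uE] := iter_rmorphism sigma (2 ^ a).
by rewrite -uE rmorphD fmorphV uE iter_sigma_flip // invrN -opprD.
Qed.

(** By induction u agrees with a power of sigma on z^2 + 1/z^2, hence on the square of z + 1/z. On z
    + 1/z itself they agree up to sign, and a wrong sign is corrected by the power 2^a of sigma,
    which negates z + 1/z. *)
Lemma aut_add_inv_iter a z (u : {rmorphism algC -> algC}) : z ^+ (2 ^ a.+1) = -1 ->
  exists i, u (z + z^-1) = iter i sigma (z + z^-1).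
Proof.
elim: a z => [|a IHa] z zN1; have nz_z := root_neq0 _ _ zN1.
  exists 0%N; have /eqP -> : z + z^-1 == 0 by rewrite add_inv_eq0 // zN1.
  by rewrite rmorph0.
have z2 : (z ^+ 2) ^+ (2 ^ a.+1) = -1 by rewrite -exprM -expnS.
have [i ui] := IHa _ z2; have [v vE] := iter_rmorphism sigma i.
have : u (z + z^-1) ^+ 2 == v (z + z^-1) ^+ 2.
  by rewrite -!rmorphXn add_inv_sqr // (rmorphD u) (rmorphD v) /= ui vE !rmorph_nat.
rewrite eqf_sqr => /orP[] /eqP ->; first by exists i.
by exists (i + 2 ^ a)%N; rewrite iterD iter_sigma_flip_add // -!vE rmorphN.
Qed.

(** In the inductive step, an iterate that fixes b = z + 1/z also fixes b^2, so its exponent is q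
    2^a by induction. It then multiplies b, which is nonzero, by (-1)^q, so q must be even. *)
Lemma iter_sigma_period a z i : z ^+ (2 ^ a.+1) = -1 ->
  (iter i sigma (z + z^-1) == z + z^-1) = (2 ^ a %| i)%N.
Proof.
elim: a z i => [|a IHa] z i zN1; have nz_z := root_neq0 _ _ zN1.
  have /eqP -> : z + z^-1 == 0 by rewrite add_inv_eq0 // zN1.
  by have [v vE] := iter_rmorphism sigma i; rewrite -vE rmorph0 eqxx dvd1n.
have z2 : (z ^+ 2) ^+ (2 ^ a.+1) = -1 by rewrite -exprM -expnS.
set b := z + z^-1.
have nz_b : b != 0.
  rewrite add_inv_eq0 //; apply: contra_eq_neq (z2) => ->.
  by rewrite expnS exprM sqrrN !expr1n -subr_eq0 opprK -mulr2n pnatr_eq0.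
have flipM q : iter (2 ^ a * q) sigma b = (-1) ^+ q * b.
  elim: q => [|q IHq]; first by rewrite muln0 mul1r.
  have [v vE] := iter_rmorphism sigma (2 ^ a).
  rewrite mulnS iterD IHq -vE rmorphM rmorph_sign vE iter_sigma_flip_add //.
  by rewrite exprS mulrN mulN1r mulNr.
have [v vE] := iter_rmorphism sigma i.
have iter_dvd : iter i sigma b = b -> (2 ^ a %| i)%N.
  move=> ib; rewrite -(IHa _ _ z2).
  have /eqP := congr1 (fun t => t ^+ 2) ib.
  by rewrite -vE -rmorphXn add_inv_sqr // rmorphD rmorph_nat (inj_eq (addIr _)) vE.
have [/dvdnP[q ->] | ndvd] := boolP (2 ^ a %| i)%N; last first.
  apply/eqP/idP => [/iter_dvd | dvd]; first by rewrite (negPf ndvd).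
  by rewrite (dvdn_trans _ dvd) ?dvdn_exp2l in ndvd.
rewrite mulnC flipM expnSr dvdn_pmul2l ?expn_gt0 // dvdn2 -signr_odd.
case: (odd q); rewrite ?mul1r ?eqxx // mulN1r -subr_eq0 -opprD oppr_eq0 -mulr2n.
by rewrite mulrn_eq0 (negPf nz_b).
Qed.

End TwoPower.

(** * Cyclotomic fields *)

Lemma cyclotomic_field_exists N : (0 < N)%N ->
  exists (L : splittingFieldType rat) (LtoC : {rmorphism L -> algC}) (w : L),
    [/\ galois 1 {:L}, N.-primitive_root w & <<1; w>>%VS = fullv].
Proof.
case: N => // N _.
(* [group_num_field_exists] yields the cyclotomic field whose conductor is the order of a given
   finite group; any group of order [N.+1] serves. *)
have [L galL [LtoC _ [w [prim_w genw] _]]] := group_num_field_exists [set: 'I_N.+1]%G.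
by exists L, LtoC, w; split=> //; rewrite cardsT card_ord in prim_w.
Qed.

Section NumberFieldAutomorphisms.
Variables (L : splittingFieldType rat) (LtoC : {rmorphism L -> algC}).
Let G := 'Gal({:L} / 1)%G.
Implicit Type g : gal_of {:L}.

Lemma gal_extension g : exists u : {rmorphism algC -> algC},
  forall x, u (LtoC x) = LtoC (g x).
Proof. by have [u uE] := extend_algC_subfield_aut LtoC g; exists u => x; rewrite -uE. Qed.

Lemma gal_restriction (u : {rmorphism algC -> algC}) :
  exists2 g, g \in G & forall x, LtoC (g x) = u (LtoC x).
Proof.
have [v vE] := restrict_aut_to_normal_num_field LtoC u.
have homv : kHom 1 {:L} (linfun v).
  apply/kHomP_tmp; split=> [_ /vlineP[r ->] | x y _ _];
    by rewrite !lfunE /= ?linearZ ?rmorph1 ?rmorphM.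
have /kAut_to_gal[g Gg vg] : kAut 1 {:L} (linfun v) by rewrite kAutfE.
by exists g => // x; rewrite -vg ?memvf // lfunE /= vE.
Qed.

Lemma LtoC_iter g (u : {rmorphism algC -> algC}) i x :
  (forall x, LtoC (g x) = u (LtoC x)) -> LtoC (iter i g x) = iter i u (LtoC x).
Proof. by move=> gu; elim: i => //= i IHi; rewrite gu IHi. Qed.

End NumberFieldAutomorphisms.

Section CyclotomicField.
Variables (L : splittingFieldType rat) (LtoC : {rmorphism L -> algC}) (w : L) (N : nat).
Hypotheses (prim_w : N.-primitive_root w) (genw : <<1; w>>%VS = fullv).
Let G := 'Gal({:L} / 1)%G.

Lemma gal_cyclotomic (g : gal_of {:L}) : exists k, g w = w ^+ k.
Proof.
have: (g w) ^+ N = 1 by rewrite -rmorphXn (prim_expr_order prim_w) rmorph1.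
by case/(prim_rootP prim_w) => k ->; exists k.
Qed.

Lemma gal_cyclotomic_eq (g h : gal_of {:L}) : g w = h w -> g = h.
Proof.
move=> ghw; apply/eqP/gal_eqP => a _; apply: (gal_eq_adjoin _ _ _ w) => //.
by rewrite genw memvf.
Qed.

Lemma cyclotomic_abelian : abelian G.
Proof.
apply/centsP => g _ h _; apply: gal_cyclotomic_eq.
have [[i gw] [j hw]] := (gal_cyclotomic g, gal_cyclotomic h).
by rewrite !galM ?memvf // gw hw !rmorphXn /= gw hw exprAC.
Qed.

(** Since m divides d, N = dm divides d^2, so (1 + d)^i = 1 + id modulo N. The automorphism sending
    [w] to w^(1 + d) therefore has order divisible by m. *)
Lemma dvdn_exponent_cyclotomic d m : (0 < d)%N -> (m %| d)%N -> N = (d * m)%N ->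
  (m %| exponent G)%N.
Proof.
move=> d_gt0 dv_md defN.
have co_kN : coprime (1 + d) N.
  have co_d : coprime (1 + d) d by rewrite add1n coprimeSn.
  by rewrite defN coprimeMr co_d (coprime_dvdr dv_md).
have [u uE] := Qn_aut_exists co_kN.
have [t Gt tE] := gal_restriction _ LtoC u.
have tw : t w = w ^+ (1 + d).
  apply/(fmorph_inj LtoC); rewrite tE rmorphXn uE // -rmorphXn.
  by rewrite (prim_expr_order prim_w) rmorph1.
have tXw i : (t ^+ i)%g w = w ^+ ((1 + d) ^ i).
  elim: i => [|i IHi]; first by rewrite gal_id.
  by rewrite expgSr galM ?memvf // IHi rmorphXn /= tw -exprM expnS.
have kX i : (1 + d) ^ i = 1 + i * d %[mod N].
  elim: i => // i IHi; rewrite expnS -modnMmr IHi modnMmr.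
  have [q dq] := dvdnP dv_md.
  have -> : ((1 + d) * (1 + i * d) = (i * q) * N + (1 + i.+1 * d))%N.
    rewrite defN -[(i * q * (d * m))%N]mulnA [(q * (d * m))%N]mulnCA -dq mulSn.
    rewrite mulnDl mul1n mulnDr muln1 [(d * (i * d))%N]mulnCA.
    by rewrite addnA [RHS]addnC -(addnA 1%N) (addnC d).
  by rewrite modnMDl.
apply: dvdn_trans (dvdn_exponent Gt).
have /eqP := tXw #[t]%g; rewrite expg_order gal_id -{1}[w]expr1 (eq_prim_root_expr prim_w).
rewrite kX eq_sym eqn_mod_dvd ?leq_addr // addKn defN mulnC dvdn_pmul2r //.
Qed.

End CyclotomicField.

(** * Cyclic polynomials *)

Lemma minPoly_rat (L : fieldExtType rat) (x : L) :
  exists2 f : {poly rat}, minPoly 1 x = map_poly (in_alg L) f & irreducible_poly f.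
Proof.
have /polyOver1P[f Df] := minPolyOver 1 x; exists f => //.
have size_f q : size (map_poly (in_alg L) q) = size q by rewrite size_map_poly.
split=> [|q size_q q_dv_f].
  rewrite -size_f -Df; apply: root_size_gt1 (root_minPoly 1 x).
  by rewrite monic_neq0 ?monic_minPoly.
have /(minPoly_irr _) : map_poly (in_alg L) q %| minPoly 1 x by rewrite Df dvdp_map.
move=> /(_ (alg_polyOver _ _)) /orP[].
  by rewrite Df eqp_map.
by move/eqp_size; rewrite size_f size_poly1 => eq1; rewrite eq1 in size_q.
Qed.

(** Group form of the facts on z + 1/z: [aut_add_inv_iter] shows that the restriction [s] of sigma
    generates the quotient, and [iter_sigma_period] gives its order. *)
Lemma two_power_cyclic_mod (L : splittingFieldType rat) (LtoC : {rmorphism L -> algC})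
    (sigma : {rmorphism algC -> algC}) (s : gal_of {:L}) (z : L) a :
  (forall z, z ^+ 8 = 1 -> sigma z = z ^+ 5) ->
  abelian 'Gal({:L} / 1)%g -> s \in 'Gal({:L} / 1)%g ->
  (forall x, LtoC (s x) = sigma (LtoC x)) -> z ^+ (2 ^ a.+1) = -1 ->
  cyclic_mod _ 'Gal({:L} / 1)%G 'Gal({:L} / <<1; z + z^-1>>)%G s (2 ^ a).
Proof.
move=> sigma8 cGG Gs sE zN1; set b := z + z^-1.
have zC : LtoC z ^+ (2 ^ a.+1) = -1 by rewrite -rmorphXn zN1 rmorphN1.
have bC : LtoC b = LtoC z + (LtoC z)^-1 by rewrite rmorphD fmorphV.
split=> //.
- by rewrite galS // sub1v.
- apply/subsetP => g Gg.
  have [u uE] := gal_extension _ LtoC g.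
  have [i ui] := aut_add_inv_iter sigma sigma8 a _ u zC.
  have gb : g b = (s ^+ i)%g b.
    apply: (fmorph_inj LtoC); rewrite -uE bC ui galX.
    by rewrite (LtoC_iter _ LtoC _ sigma) // bC.
  have -> : g = (s ^+ i * (g * s ^- i))%g.
    by rewrite mulgA (centsP cGG _ (groupX i Gs) g Gg) mulgK.
  rewrite mem_mulg ?mem_cycle //= mem_gal_adjoin galM ?memvf // gb -galM ?memvf //.
  by rewrite mulgV gal_id.
move=> i; rewrite /= mem_gal_adjoin galX -(inj_eq (fmorph_inj LtoC)).
by rewrite (LtoC_iter _ LtoC _ sigma) // bC (iter_sigma_period sigma sigma8 a).
Qed.

(* c acts on the n conjugates of alpha (the roots of f) as an n-cycle, and every
   automorphism acts on them as a power of c. *)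
Definition cyclic_conjugates (n : nat) (alpha : algC) (c : {rmorphism algC -> algC})
    (f : {poly rat}) : Prop :=
  [/\ forall u : {rmorphism algC -> algC},
        exists i, forall j, u (iter j c alpha) = iter (i + j) c alpha,
      forall i, (iter i c alpha == alpha) = (n %| i)%N,
      map_poly ratr f = \prod_(b <- traject c alpha n) ('X - b%:P)
    & irreducible_poly f].

Lemma cyclic_conjugates_exist (sigma : {rmorphism algC -> algC}) n :
  (forall z, z ^+ 8 = 1 -> sigma z = z ^+ 5) -> (0 < n)%N ->
  exists f alpha c, cyclic_conjugates n alpha c f /\
    forall k, sigma alpha = iter k c alpha -> ~~ odd n -> odd k.
Proof.
move=> sigma8 n_gt0.
have [m co2m defn] := pfactor_coprime (isT : prime 2) n_gt0.
set a := logn 2 n in defn.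
have m_gt0 : (0 < m)%N by move: n_gt0; rewrite defn muln_gt0 => /andP[].
(* The factor m in [d] meets the requirement of [dvdn_exponent_cyclotomic] that m divide d, and the
   factor 2^(a+2) makes w^(m^2) a primitive 2^(a+2)-th root of unity. *)
pose d := (2 ^ a.+2 * m)%N; pose N := (d * m)%N.
have d_gt0 : (0 < d)%N by rewrite muln_gt0 expn_gt0.
have N_gt0 : (0 < N)%N by rewrite muln_gt0 d_gt0.
have [L [LtoC [w [galL prim_w genw]]]] := cyclotomic_field_exists N N_gt0.
have cGG := cyclotomic_abelian _ w N prim_w genw.
pose z := w ^+ (m * m).
have zN1 : z ^+ (2 ^ a.+1) = -1.
  have /eqP : z ^+ (2 ^ a.+1) ^+ 2 = 1.
    rewrite -!exprM -mulnA -expnSr -(prim_expr_order prim_w); congr (_ ^+ _).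
    by rewrite /N /d mulnC (mulnC m).
  rewrite sqrf_eq1 => /orP[] /eqP // z1.
  have : (N %| m * m * 2 ^ a.+1)%N by rewrite (prim_order_dvd prim_w) exprM -/z z1.
  rewrite /N /d -mulnA mulnC dvdn_pmul2l ?muln_gt0 ?m_gt0 //.
  by rewrite dvdn_Pexp2l // ltnn.
have [s Gs sE] := gal_restriction _ LtoC sigma.
have cm1 := two_power_cyclic_mod L LtoC sigma s z a sigma8 cGG Gs sE zN1.
have dvm : (m %| exponent 'Gal({:L} / 1))%N.
  by apply: (dvdn_exponent_cyclotomic L LtoC w N prim_w d) => //; rewrite dvdn_mull.
have [H2 [c2 cm2]] := cyclic_mod_exponent _ _ m cGG dvm.
have co_am : coprime (2 ^ a) m by rewrite coprimeXl.
have [c cmc] := cyclic_modI _ cGG co_am (expn_gt0 _ _) m_gt0 cm1 cm2.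
rewrite mulnC -defn in cmc.
set H := (_ :&: _)%G in cmc.
have [Gc sHG _ ordc] := cmc.
(* [x] generates the compositum of the real subfield of degree 2^a and the chosen subfield of degree
   m. *)
have [x stabx] := stabilizer_generator L galL H.
have Dp := minPoly_cyclic L galL H c n x cGG n_gt0 cmc stabx.
have [f Df irr_f] := minPoly_rat L x.
have [cC cE] := gal_extension _ LtoC c.
have iterC i y : LtoC (iter i c y) = iter i cC (LtoC y) by apply: LtoC_iter.
exists f, (LtoC x), cC; split; first split=> //.
- move=> u; have [g Gg gu] := gal_restriction _ LtoC u.
  have [i gx] := cyclic_mod_iter L H c n g x cGG cmc stabx Gg; exists i => j.
  rewrite -!iterC -gu; congr (LtoC _); rewrite addnC iterD -gx -!galX -!galM ?memvf //.
  by rewrite (centsP cGG (c ^+ j)%g) ?groupX.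
- by move=> i; rewrite -iterC (inj_eq (fmorph_inj LtoC)) -galX stabx ordc.
- have -> : map_poly ratr f = map_poly LtoC (minPoly 1 x).
    rewrite Df -map_poly_comp; apply: eq_map_poly => r /=.
    by rewrite alg_num_field fmorph_rat.
  have -> : traject cC (LtoC x) n = map LtoC (traject c x n).
    by elim: (n) (x) => //= k IHk y; rewrite -IHk cE.
  rewrite Dp rmorph_prod big_map; apply: eq_bigr => y _.
  by rewrite rmorphB /= map_polyX map_polyC.
move=> k sk ev_n.
apply: (odd_cyclic_mod _ cGG _ cm1 cmc) => //.
(* The degree 2^a is even, for a = 0 would make n = m, which is odd. *)
- rewrite oddX orbF; apply: contra ev_n => /eqP a0.
  by rewrite defn a0 muln1 -coprime2n.
- exact: subsetIl.
have sc : commute (c ^- k)%g s by apply: (centsP cGG); rewrite ?groupV ?groupX.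
rewrite sc -stabx galM ?memvf //.
have -> : s x = (c ^+ k)%g x by apply: (fmorph_inj LtoC); rewrite sE sk galX iterC.
by rewrite -galM ?memvf // mulgV gal_id.
Qed.

(** * Signs on the roots and Galois groups of splitting fields *)

Lemma perm_of_stable_seq {T : eqType} (x0 : T) (rs : seq T) (v : T -> T) :
  uniq rs -> injective v -> {homo v : x / x \in rs} ->
  exists p : {perm 'I_(size rs)}, forall i, nth x0 rs (p i) = v (nth x0 rs i).
Proof.
move=> uniq_rs injv rsv.
have lt_index (i : 'I_(size rs)) : (index (v (nth x0 rs i)) rs < size rs)%N.
  by rewrite index_mem rsv ?mem_nth.
pose g i := Ordinal (lt_index i).
have nth_g i : nth x0 rs (g i) = v (nth x0 rs i) by rewrite nth_index ?rsv ?mem_nth.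
have injg : injective g.
  move=> i j eq_g; apply/val_inj/eqP; rewrite -(nth_uniq x0 (ltn_ord i) (ltn_ord j) uniq_rs).
  by apply/eqP/injv; rewrite -!nth_g eq_g.
by exists (perm injg) => i; rewrite permE nth_g.
Qed.

Lemma odd_permX {T : finType} (p : {perm T}) k : odd_perm (p ^+ k)%g = odd k && odd_perm p.
Proof.
elim: k => [|k IHk]; first by rewrite odd_perm1.
by rewrite expgS odd_permM IHk /=; case: (odd k); case: (odd_perm p).
Qed.

(** The condition tested by [pick] prescribes every value of the permutation, so the search can only
    return [p]; the existence of [p] excludes the default value 0. *)
Lemma perm_sign_onE (sigma : algC -> algC) (f : {poly rat})
    (p : {perm 'I_(size (rootsC f))}) : uniq (rootsC f) ->
  (forall i, nth 0 (rootsC f) (p i) = sigma (nth 0 (rootsC f) i)) ->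
  perm_sign_on sigma f = (-1) ^+ odd_perm p.
Proof.
move=> uniq_rs pE; rewrite /perm_sign_on.
have p_index i : p i = index (sigma (nth 0 (rootsC f) i)) (rootsC f) :> nat.
  by rewrite -pE index_uniq.
case: pickP => [s /forallP sP | /(_ p) /forallP[]]; last by move=> i; rewrite p_index.
by have -> : s = p by apply/permP => i; apply: val_inj; rewrite /= (eqP (sP i)) p_index.
Qed.

Lemma gal_eq1 {E : splittingFieldType rat} (s : seq E) (g : gal_of {:E}) :
  <<1 & s>>%VS = fullv -> {in s, forall y, g y = y} -> g = 1%g.
Proof.
move=> gens gs; apply/eqP/gal_eqP => a _; rewrite gal_id.
have s_a : a \in <<1 & s>>%VS by rewrite gens memvf.
apply/fixedSpaceP; apply: subvP s_a; apply/Fadjoin_seqP; split; first exact: sub1v.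
by move=> y /gs gy; apply/fixedSpaceP.
Qed.

Section CyclicConjugates.
Variables (n : nat) (alpha : algC) (c : {rmorphism algC -> algC}) (f : {poly rat}).
Hypotheses (n_gt0 : (0 < n)%N) (cc : cyclic_conjugates n alpha c f).

Lemma cyclic_conjugates_monic : f \is monic.
Proof.
by have [_ _ Df _] := cc; rewrite -(map_monic (ratr : rat -> algC)) Df monic_prod_XsubC.
Qed.

Lemma size_cyclic_conjugates : (size f).-1 = n.
Proof.
have [_ _ Df _] := cc.
by rewrite -(size_map_poly (ratr : rat -> algC)) Df size_prod_XsubC size_traject.
Qed.

Lemma perm_rootsC : perm_eq (rootsC f) (traject c alpha n).
Proof.
have [_ _ Df _] := cc; rewrite /rootsC; case: closed_field_poly_normal => rs /= Drs.
apply: prod_XsubC_eq; rewrite -Df Drs.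
by rewrite Df (monicP (monic_prod_XsubC _ _ _)) scale1r.
Qed.

(** On the roots sigma is the k-th power of the n-cycle [p] induced by c. Either n is odd and [p] is
    even, or n is even and the odd power of [p] keeps its sign (-1)^(n-1). *)
Lemma cyclic_conjugates_sign (sigma : {rmorphism algC -> algC}) :
  (forall k, sigma alpha = iter k c alpha -> ~~ odd n -> odd k) ->
  perm_sign_on sigma f = (-1) ^+ n.+1.
Proof.
move=> odd_k; have [autP period Df _] := cc; have perm_rs := perm_rootsC.
have injc : injective c := fmorph_inj c.
have mem_rs : rootsC f =i traject c alpha n := perm_mem perm_rs.
have uniq_rs : uniq (rootsC f).
  by rewrite (perm_uniq perm_rs) (uniq_traject_period c alpha n).
have rs_iter i : iter i c alpha \in rootsC f.
  by rewrite mem_rs (mem_traject_period c alpha n).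
have rsP x : x \in rootsC f -> exists j, x = iter j c alpha.
  by rewrite mem_rs => /trajectP[j _ ->]; exists j.
have [k sigmaE] := autP sigma.
have [|p pE] := perm_of_stable_seq 0 (rootsC f) c uniq_rs injc.
  by move=> x /rsP[j ->]; apply: (rs_iter j.+1).
have pXE i j : nth 0 (rootsC f) ((p ^+ j)%g i) = iter j c (nth 0 (rootsC f) i).
  by elim: j => [|j IHj]; rewrite ?perm1 // expgSr permM pE IHj.
rewrite (perm_sign_onE sigma f (p ^+ k)%g) // => [|i]; last first.
  by rewrite pXE; have [j ->] := rsP _ (mem_nth 0 (ltn_ord i)); rewrite sigmaE iterD.
(* Every root is an iterate of [alpha] under c, so [p] has a single orbit; the parity of [p] is that
   of n minus the number of orbits. *)
have porbits1 : #|porbits p| = 1%N.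
  have lt0 : (index alpha (rootsC f) < size (rootsC f))%N by rewrite index_mem (rs_iter 0%N).
  pose i0 := Ordinal lt0; have nth_i0 : nth 0 (rootsC f) i0 = alpha.
    by rewrite nth_index ?(rs_iter 0%N).
  apply/eqP/cards1P; exists (porbit p i0); apply/setP => X; rewrite inE.
  apply/imsetP/eqP => [[i _ ->] | ->]; last by exists i0.
  have [j nth_i] := rsP _ (mem_nth 0 (ltn_ord i)).
  have -> : i = (p ^+ j)%g i0; last exact: porbit_perm.
  apply/val_inj/eqP; rewrite -(nth_uniq 0 (ltn_ord i) (ltn_ord _) uniq_rs).
  by rewrite pXE nth_i0 nth_i.
have size_rs : size (rootsC f) = n by rewrite (perm_size perm_rs) size_traject.
rewrite odd_permX /odd_perm porbits1 card_ord size_rs addbT -signr_odd.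
have := sigmaE 0%N; rewrite addn0 => /odd_k; rewrite -[RHS]signr_odd /=.
by case: (odd n) => [_ | ->] //; rewrite andbF.
Qed.

(** In the field generated by the roots, every automorphism acts on the roots as a power of c, hence
    is a power of the restriction [d] of c. *)
Lemma cyclic_conjugates_galois : cyclic_galois_of_order f n.
Proof.
have [autP period Df _] := cc.
set rs := traject c alpha n in Df.
have [E [EtoC [s1 Ds1 gens1]]] := num_field_exists rs.
have Df1 : map_poly (in_alg E) f = \prod_(b <- s1) ('X - b%:P).
  apply: (map_poly_inj EtoC).
  rewrite -map_poly_comp rmorph_prod (_ : map_poly _ f = map_poly ratr f); last first.
    by apply: eq_map_poly => r /=; rewrite alg_num_field fmorph_rat.
  rewrite Df -Ds1 big_map; apply: eq_bigr => y _.
  by rewrite rmorphB /= map_polyX map_polyC.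
have splitE : splittingFieldFor 1 (map_poly (in_alg E) f) {:E}.
  by exists s1; rewrite // Df1 eqpxx.
have E_ax : FieldExt_isSplittingField _ E.
  by constructor; exists (map_poly (in_alg E) f) => //; apply: alg_polyOver.
pose E' := HB.pack_for (splittingFieldType rat) E E_ax.
exists E'; split=> //.
have [d Gd dE] := gal_restriction E' EtoC c.
have sP y : y \in s1 -> exists j, EtoC y = iter j c alpha.
  move=> /(map_f EtoC); rewrite Ds1 => /trajectP[j _ ->]; by exists j.
have dX i y : EtoC ((d ^+ i)%g y) = iter i c (EtoC y).
  by rewrite galX (LtoC_iter E' EtoC _ c).
have GalE : 'Gal({:E'} / 1)%g = <[d]>%g.
  apply/eqP; rewrite eqEsubset cycle_subG Gd andbT; apply/subsetP => g Gg.
  have [u uE] := gal_extension E' EtoC g; have [i ui] := autP u.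
  suffices /(canRL (mulgKV _)) -> : (g * d ^- i = 1)%g by rewrite mul1g mem_cycle.
  apply: (@gal_eq1 E' s1) => // y s_y; rewrite galM ?memvf //.
  have -> : g y = (d ^+ i)%g y.
    apply: (fmorph_inj EtoC); rewrite -uE dX; have [j ->] := sP y s_y.
    by rewrite ui iterD.
  by rewrite -galM ?memvf // mulgV gal_id.
rewrite GalE cycle_cyclic -orderE; split=> //.
have [y0 s_y0 y0E] : exists2 y, y \in s1 & alpha = EtoC y.
  by apply/mapP; rewrite Ds1; apply/trajectP; exists 0%N.
(* The order of [d] is n by mutual divisibility: d^#[d] fixes [alpha], whose period is n, and c^n
   fixes every root, so d^n = 1. *)
apply/eqP; rewrite eqn_dvd -period order_dvdn {1}y0E -dX expg_order gal_id -y0E eqxx andbT.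
apply/eqP/(@gal_eq1 E' s1) => // y s_y; apply: (fmorph_inj EtoC); rewrite dX.
have [j ->] := sP y s_y; apply/eqP.
by rewrite -iterD addnC iterD (inj_eq (iter_injective c j (fmorph_inj c))) period.
Qed.
End CyclicConjugates.

Theorem theorem3 (A : fieldExtType rat) (nu : (A -> Prop) -> nat)
  (nu_additive : forall I J, nz_ideal I -> nz_ideal J -> id_coprime I J ->
     nu (idmul I J) = (nu I + nu J)%N)
  (nu_pos : forall I, nz_ideal I -> I <> @ring_of_integers A -> (0 < nu I)%N) :
  exists (f : (A -> Prop) -> {poly rat}) (sigma : {rmorphism algC -> algC}),
    bijective sigma /\
    (forall P, nz_prime_ideal P ->
       [/\ f P \is monic, irreducible_poly (f P), (size (f P)).-1 = nu P
         & cyclic_galois_of_order (f P) (nu P)]) /\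
    (forall ps : seq (A -> Prop),
       (forall i, (i < size ps)%N -> nz_prime_ideal (nth (@ring_of_integers A) ps i)) ->
       distinct_ideals ps ->
       mobius_sqf ps =
         (-1) ^+ nu (idprod ps) *
         \prod_(P <- ps) perm_sign_on sigma (f P)).
Proof.
(* One sigma serves all degrees, since only its action on the eighth roots of unity is
   prescribed. *)
have [sigma sigma8] := Qn_aut_exists (isT : coprime 5 8).
have F_ex n : exists f, (0 < n)%N ->
    [/\ f \is monic, irreducible_poly f, (size f).-1 = n
      & cyclic_galois_of_order f n] /\ perm_sign_on sigma f = (-1) ^+ n.+1.
  (* The value in degree 0 is a placeholder: [nu] is positive at every nonzero prime. *)
  case: n => [|n]; first by exists 0.
  have [f [alpha [c [cc odd_k]]]] := cyclic_conjugates_exist sigma n.+1 sigma8 (ltn0Sn n).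
  exists f => n_gt0; split; last exact: (cyclic_conjugates_sign _ _ _ _ n_gt0 cc).
  split.
  - exact: cyclic_conjugates_monic cc.
  - by case: cc.
  - exact: size_cyclic_conjugates cc.
  - exact: cyclic_conjugates_galois n_gt0 cc.
pose F n := sval (constructive_indefinite_description _ (F_ex n)).
have FP n : (0 < n)%N -> [/\ F n \is monic, irreducible_poly (F n), (size (F n)).-1 = n
      & cyclic_galois_of_order (F n) n] /\ perm_sign_on sigma (F n) = (-1) ^+ n.+1.
  exact: (svalP (constructive_indefinite_description _ (F_ex n))).
have nu_prime P : nz_prime_ideal P -> (0 < nu P)%N.
  case=> nzP notP1 _; apply: nu_pos => // eqP; apply: notP1.
  by rewrite eqP; apply: integral1A.
exists (fun P => F (nu P)), sigma; split.
  by exists (algC_invaut sigma); [apply: algC_autK | apply: algC_invautK].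
split=> [P /nu_prime /FP[] // | ps prps dps].
rewrite (additive_idprod A nu ps nu_additive prps dps) /mobius_sqf.
elim: ps prps {dps} => [|P ps IHps] prps; first by rewrite !big_nil mulr1.
rewrite !big_cons (proj2 (FP _ (nu_prime _ (prps 0%N (ltn0Sn _))))) /=.
rewrite exprS IHps => [|i lti]; last exact: (prps i.+1).
(* Each prime contributes (-1)^(nu P) (-1)^(nu P + 1) = -1, the factor it has in the Moebius
   function. *)
rewrite exprD (exprS _ (nu P)) mulrACA; congr (_ * _).
by rewrite mulrCA -exprD addnn -signr_odd odd_double mulr1.
Qed.
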